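(* Let $(V,* )$ be a Jordan algebra over a field $F$ of characteristic different from $2$. Then for all $a,b\in V$, $$Q_{Q_a b} = Q_aQ_bQ_a$$ as linear maps $V\to V$.
   Context: A Jordan algebra $(V,* )$ over a field $F$ (always assumed of characteristic $\neq 2$) is an $F$-vector space $V$ with a bilinear operation $*:V\times V\to V$ such that for all $a,b\in V$: $a*b=b*a$ and $a*(b*a^2)=(a*b)*a^2$, where $a^2:=a*a$. The product is not assumed associative or unital, and $V$ is not assumed finite-dimensional. For $a\in V$ the quadratic representation is the linear map $Q_a:V\to V$ given by $Q_a b := 2\,a*(a*b) - a^2*b$. Products of maps denote composition. *)

(* Defs.v *)
From HB Require Import structures.
From mathcomp Require Import all_boot all_order all_algebra.

Set Implicit Arguments.
Unset Strict Implicit.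
Unset Printing Implicit Defensive.

Import GRing.Theory.
Local Open Scope ring_scope.

(* The characteristic assumption is not part of the structure; it is stated
   separately, as 2 \notin [pchar F]. *)
Record jordanProduct (F : fieldType) (V : lmodType F) := JordanProduct {
  jmul :> {bilinear V -> V -> V};
  jmulC : forall a b : V, jmul a b = jmul b a;
  jmul_jordan : forall a b : V,
    jmul a (jmul b (jmul a a)) = jmul (jmul a b) (jmul a a)
}.

Definition quadrep (F : fieldType) (V : lmodType F) (J : jordanProduct V)
    (a b : V) : V :=
  2%:R *: J a (J a b) - J (J a a) b.

Lemma quadrep_is_linear (F : fieldType) (V : lmodType F) (J : jordanProduct V)
  (a : V) : linear (quadrep J a).
Proof.
move=> k x y; rewrite /quadrep !linearPr /= scalerDr scalerBr !scalerA.
by rewrite [2%:R * k]mulrC opprD addrACA.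
Qed.

HB.instance Definition _ (F : fieldType) (V : lmodType F)
    (J : jordanProduct V) (a : V) :=
  GRing.isLinear.Build F V V *:%R (quadrep J a) (quadrep_is_linear J a).

(* Main.v *)
Require Import Defs.
From mathcomp Require Import all_boot all_order all_algebra.

Set Implicit Arguments.
Unset Strict Implicit.
Unset Printing Implicit Defensive.

Import GRing.Theory.
Local Open Scope ring_scope.

(** Put {x y z} = (xy)z + x(yz) - y(xz), so that Q_a b = {a b a}.  The
    polarized Jordan identity makes [L_x, L_y] a derivation, which gives
    w{u v z} = {wu v z} - {u wv z} + {u v wz} and hence the five-linear identity
      {x y {u v z}} - {u v {x y z}} = {{x y u} v z} - {u {y x v} z},
    as well as {x y {x z x}} = {x {y x z} x}.  With q = {x y x} and
    r = {y x y}, these two give {x c q} = {x {y x c} x}, then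
    {q c q} = {x (2 {y x {y x c}} - {r x c}) x}, and finally
    2 {y x {y x c}} - {r x c} = {y {x c x} y}. *)

(** Reflection for identities that follow from bilinearity and commutativity alone; the Jordan
    identity enters through [eq_combine]. There are no scalars, so the lemmas below write doubling
    as a repeated sum. *)
Inductive jterm :=
  | JVar of nat
  | JMul of jterm & jterm
  | JAdd of jterm & jterm
  | JOpp of jterm.

(** Fixes an order of the two factors, so that monomials equal up to commutativity become the same
    tree. *)
Fixpoint jmono_le (s t : GenTree.tree nat) : bool :=
  match s, t with
  | GenTree.Leaf m, GenTree.Leaf n => (m <= n)%N
  | GenTree.Leaf _, _ => true
  | GenTree.Node _ [:: s1; s2], GenTree.Node _ [:: t1; t2] =>
      if s1 == t1 then jmono_le s2 t2 else jmono_le s1 t1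
  | _, _ => false
  end.

Definition jmono_mul (s t : GenTree.tree nat) : GenTree.tree nat :=
  if jmono_le s t then GenTree.Node 0 [:: s; t] else GenTree.Node 0 [:: t; s].

(* The positive and the negative monomials of a term, with repetition. *)
Fixpoint jnorm (e : jterm) : seq (GenTree.tree nat) * seq (GenTree.tree nat) :=
  match e with
  | JVar n => ([:: GenTree.Leaf n], [::])
  | JMul e1 e2 =>
      let: (p1, n1) := jnorm e1 in let: (p2, n2) := jnorm e2 in
      (allpairs jmono_mul p1 p2 ++ allpairs jmono_mul n1 n2,
       allpairs jmono_mul p1 n2 ++ allpairs jmono_mul n1 p2)
  | JAdd e1 e2 =>
      let: (p1, n1) := jnorm e1 in let: (p2, n2) := jnorm e2 in
      (p1 ++ p2, n1 ++ n2)
  | JOpp e1 => let: (p1, n1) := jnorm e1 in (n1, p1)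
  end.

Section JordanAlgebra.

Variables (F : fieldType) (V : lmodType F) (J : jordanProduct V).

Fixpoint jeval (env : seq V) (e : jterm) : V :=
  match e with
  | JVar n => nth 0 env n
  | JMul e1 e2 => J (jeval env e1) (jeval env e2)
  | JAdd e1 e2 => jeval env e1 + jeval env e2
  | JOpp e1 => - jeval env e1
  end.

Fixpoint jmono_eval (env : seq V) (t : GenTree.tree nat) : V :=
  match t with
  | GenTree.Leaf n => nth 0 env n
  | GenTree.Node _ [:: s; t] => J (jmono_eval env s) (jmono_eval env t)
  | _ => 0
  end.

Lemma jmono_evalM env s t :
  jmono_eval env (jmono_mul s t) = J (jmono_eval env s) (jmono_eval env t).
Proof. by rewrite /jmono_mul; case: ifP => _ //=; rewrite jmulC. Qed.

Lemma sum_jmono_evalM env s t :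
  \sum_(x <- allpairs jmono_mul s t) jmono_eval env x =
  J (\sum_(x <- s) jmono_eval env x) (\sum_(x <- t) jmono_eval env x).
Proof.
rewrite big_allpairs_dep linear_sumlz; apply: eq_bigr => x _.
by rewrite linear_sumr; apply: eq_bigr => y _; rewrite jmono_evalM.
Qed.

Lemma jnormE env e :
  jeval env e = \sum_(t <- (jnorm e).1) jmono_eval env t
              - \sum_(t <- (jnorm e).2) jmono_eval env t.
Proof.
elim: e => [n|e1 IH1 e2 IH2|e1 IH1 e2 IH2|e1 IH1] /=.
- by rewrite big_seq1 big_nil subr0.
- rewrite IH1 IH2; case: (jnorm e1) (jnorm e2) => [p1 n1] [p2 n2] /=.
  rewrite !big_cat /= !sum_jmono_evalM linearBl /= !linearBr /=.
  by rewrite opprB addrACA opprD.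
- rewrite IH1 IH2; case: (jnorm e1) (jnorm e2) => [p1 n1] [p2 n2] /=.
  by rewrite !big_cat /= opprD addrACA.
- by rewrite IH1; case: (jnorm e1) => p1 n1 /=; rewrite opprB.
Qed.

(** Moving negative monomials across the equation leaves two multisets to compare, so no
    cancellation has to be computed. *)
Lemma jeval_eq env e1 e2 :
  perm_eq ((jnorm e1).1 ++ (jnorm e2).2) ((jnorm e2).1 ++ (jnorm e1).2) ->
  jeval env e1 = jeval env e2.
Proof.
move=> e12; apply/eqP; rewrite !jnormE subr_eq addrAC eq_sym subr_eq.
by rewrite -!big_cat /= (perm_big _ e12).
Qed.

Definition triple (x y z : V) : V := J (J x y) z + J x (J y z) - J y (J x z).

End JordanAlgebra.

Ltac jadd_atom x env :=
  let rec go l :=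
    lazymatch l with
    | nil => constr:(x :: env)
    | x :: _ => env
    | _ :: ?l' => go l'
    end in
  go env.

Ltac jatoms J t env :=
  lazymatch t with
  | ?a + ?b => let env := jatoms J a env in jatoms J b env
  | - ?a => jatoms J a env
  | Bilinear.sort (jmul J) ?a ?b =>
      let env := jatoms J a env in jatoms J b env
  | _ => jadd_atom t env
  end.

Ltac jindex x env :=
  lazymatch env with
  | x :: _ => constr:(0%N)
  | _ :: ?env' => let n := jindex x env' in constr:(S n)
  end.

Ltac jreify J t env :=
  lazymatch t with
  | ?a + ?b =>
      let a := jreify J a env in let b := jreify J b env in constr:(JAdd a b)
  | - ?a => let a := jreify J a env in constr:(JOpp a)
  | Bilinear.sort (jmul J) ?a ?b =>
      let a := jreify J a env in let b := jreify J b env in constr:(JMul a b)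
  | _ => let n := jindex t env in constr:(JVar n)
  end.

Ltac jring J :=
  rewrite /triple;
  lazymatch goal with
  | |- ?l = ?r :> ?T =>
      let env := jatoms J l (@nil T) in
      let env := jatoms J r env in
      let e1 := jreify J l env in
      let e2 := jreify J r env in
      (* [erefl true] has the [perm_eq] test decided by computation. *)
      exact: (@jeval_eq _ _ J env e1 e2 (erefl true))
  end.

Section JordanIdentities.

Variables (F : fieldType) (charF : 2%N \notin [pchar F]).
Variables (V : lmodType F) (J : jordanProduct V).

Implicit Types a b c d u v w x y z : V.

Local Notation "x ** y" := (J x y) (at level 40, left associativity).
Local Notation "{ x , y , z }" := (triple J x y z).

(** Characteristic not 2 enters here: polarization yields identities multiplied by two. *)
Lemma double_inj : injective (fun x => x + x).
Proof.
move=> x y /= /eqP; rewrite -!mulr2n -subr_eq0 -mulrnBl -scaler_nat scaler_eq0.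
case/orP=> [two0|]; last by rewrite subr_eq0 => /eqP.
by case/negP: charF; rewrite inE.
Qed.

(* Adds [l1 = r1] to [l = r], so that chaining it with [jring] verifies that an
   equation is a combination of given ones. *)
Lemma eq_combine (l r l1 r1 : V) : l1 = r1 -> l + l1 = r + r1 -> l = r.
Proof. by move=> ->; apply: addIr. Qed.

Lemma jordan_linearize1 a b c :
  c ** (b ** (a ** a)) + (a ** (b ** (a ** c)) + a ** (b ** (a ** c))) =
  (c ** b) ** (a ** a) + ((a ** b) ** (a ** c) + (a ** b) ** (a ** c)).
Proof.
apply: double_inj => /=.
(* The Jordan identity is cubic in its first argument. Its values at [a + c] and [a - c] differ by
   twice the part linear in [c] plus twice the value at [c]. *)
apply: (eq_combine (esym (jmul_jordan J (a + c) b))).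
apply: (eq_combine (jmul_jordan J (a - c) b)).
apply: (eq_combine (jmul_jordan J c b)).
apply: (eq_combine (jmul_jordan J c b)).
jring J.
Qed.

Lemma jordan_linearize a b c d :
  c ** (b ** (a ** d)) + a ** (b ** (c ** d)) + d ** (b ** (a ** c)) =
  (c ** b) ** (a ** d) + (a ** b) ** (c ** d) + (d ** b) ** (a ** c).
Proof.
apply: double_inj => /=.
apply: (eq_combine (esym (jordan_linearize1 (a + d) b c))).
apply: (eq_combine (jordan_linearize1 a b c)).
apply: (eq_combine (jordan_linearize1 d b c)).
jring J.
Qed.

(** In [jordan_linearize b c a d] the right side is symmetric in [b] and [c], so the left side is
    too. *)
Lemma mul_commutator_derivation b c a d :
  b ** (c ** (a ** d)) - c ** (b ** (a ** d)) =
  (b ** (c ** a) - c ** (b ** a)) ** d + a ** (b ** (c ** d) - c ** (b ** d)).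
Proof.
apply: (eq_combine (esym (jordan_linearize b c a d))).
apply: (eq_combine (jordan_linearize c b a d)).
jring J.
Qed.

(** Write [{u, v, z}] as (uv)z + [L_u, L_v]z: the derivation property handles the commutator,
    [jordan_linearize] the term (uv)z. *)
Lemma mul_triple w u v z :
  w ** {u, v, z} = {w ** u, v, z} - {u, w ** v, z} + {u, v, w ** z}.
Proof.
apply: (eq_combine (mul_commutator_derivation u v w z)).
apply: (eq_combine (esym (jordan_linearize u z v w))).
jring J.
Qed.

(** [{x, y, -}] is L_{xy} + [L_x, L_y]. By [mul_triple], L_{xy} acts on the middle slot with a minus
    sign and the commutator with a plus sign, which gives -[{y, x, v}] there. *)
Lemma triple_five_linear x y u v z :
  {x, y, {u, v, z}} - {u, v, {x, y, z}} =
  {{x, y, u}, v, z} - {u, {y, x, v}, z}.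
Proof.
apply: (eq_combine (esym (mul_triple (x ** y) u v z))).
apply: (eq_combine (esym (congr1 (J x) (mul_triple y u v z)))).
apply: (eq_combine (congr1 (J y) (mul_triple x u v z))).
apply: (eq_combine (esym (mul_triple x (y ** u) v z))).
apply: (eq_combine (mul_triple x u (y ** v) z)).
apply: (eq_combine (esym (mul_triple x u v (y ** z)))).
apply: (eq_combine (mul_triple y (x ** u) v z)).
apply: (eq_combine (esym (mul_triple y u (x ** v) z))).
apply: (eq_combine (mul_triple y u v (x ** z))).
jring J.
Qed.

Lemma mul_quadrep x z : x ** {x, z, x} = {x, x ** z, x}.
Proof. apply: (eq_combine (jmul_jordan J x z)); jring J. Qed.

Lemma triple_intertwine x y z : {x, y, {x, z, x}} = {x, {y, x, z}, x}.
Proof.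
apply: (eq_combine (esym (congr1 (J x) (mul_triple y x z x)))).
apply: (eq_combine (mul_triple y x (x ** z) x)).
apply: (eq_combine (congr1 (J y) (mul_quadrep x z))).
apply: (eq_combine (mul_quadrep x (y ** z))).
(* Supplies the term (xy)(x^2 z) of (xy)[{x, z, x}]. *)
apply: (eq_combine (jordan_linearize x z x (x ** y))).
jring J.
Qed.

Lemma quadrepE x y : quadrep J x y = {x, y, x}.
Proof. rewrite /quadrep scaler_nat mulr2n; jring J. Qed.

Lemma triple_quadrep x y c : {x, c, {x, y, x}} = {x, {y, x, c}, x}.
Proof.
apply: double_inj => /=.
(* As the outer slots are interchangeable, [{x, c, {x, y, x}}] occurs here twice. *)
apply: (eq_combine (triple_five_linear x y x c x)).
apply: (eq_combine (esym (triple_intertwine x y c))).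
jring J.
Qed.

(** With D = [{y, x, -}], this expresses Q_y Q_x as 2 D^2 minus the operator [{{y, x, y}, x, -}]. *)
Lemma quadrep_comp x y c :
  {y, x, {y, x, c}} + {y, x, {y, x, c}} - {{y, x, y}, x, c} =
  {y, {x, c, x}, y}.
Proof.
apply: (eq_combine (triple_five_linear c x y x y)).
jring J.
Qed.

Lemma triple_fundamental x y c :
  {{x, y, x}, c, {x, y, x}} = {x, {y, {x, c, x}, y}, x}.
Proof.
have := triple_five_linear x y x c {x, y, x}.
rewrite (triple_quadrep x y c) (triple_intertwine x y y).
rewrite (triple_intertwine x y {y, x, c}) !triple_quadrep -(quadrep_comp x).
(* The hypothesis now reads [{x, s, x} - {x, t, x} = q - {x, s, x}], with [q] the left side of the
   goal. Generalizing keeps [jring] from expanding these triples; only linearity of Q_x remains. *)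
move: ({y, x, {y, x, c}}) ({{y, x, y}, x, c}) => s t.
move: ({{x, y, x}, c, {x, y, x}}) => q E.
apply: (eq_combine E); jring J.
Qed.

End JordanIdentities.

Theorem theorem2p5 (F : fieldType) (charF : 2%N \notin [pchar F])
    (V : lmodType F) (J : jordanProduct V) (a b : V) :
  quadrep J (quadrep J a b) =1 quadrep J a \o quadrep J b \o quadrep J a.
Proof. by move=> c; rewrite /= !quadrepE triple_fundamental. Qed.
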